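(* Let $l\ge 1$ and let $G$ be a group acting isometrically, non-elliptically and non-horocyclically on each of finitely many Gromov-hyperbolic spaces $X_1,\ldots,X_l$. Let $$\mathcal{SH}(G)=\{g\in G:\ g \text{ is hyperbolic on } X_i \text{ for every } 1\le i\le l\}.$$ Then there exists a finite set $F\subset G$ such that for every $g\in G$ there exists $f\in F$ with $gf\in\mathcal{SH}(G)$.
   Context: A Gromov-hyperbolic space is a geodesic metric space $X$ that is $\delta$-hyperbolic for some $\delta\ge 0$: every side of every geodesic triangle lies in the $\delta$-neighborhood of the union of the other two sides. No properness of the space or of the action is assumed. $\partial X$ denotes the Gromov boundary (equivalence classes of sequences in $X$ converging at infinity, defined through Gromov products). For an isometric action $G\curvearrowright X$ with basepoint $x_0$, the limit set is $\Lambda(G)=\{[(x_n)]\in\partial X: \exists\, g_n\in G \text{ with } x_n=g_n x_0\}$. The action is elliptic if $|\Lambda(G)|=0$ (equivalently, orbits are bounded) and horocyclic (parabolic) if $|\Lambda(G)|=1$ (equivalently, orbits are unbounded and $G$ contains no hyperbolic element). An action is non-elliptic and non-horocyclic if and only if $G$ contains at least one hyperbolic element for it. An element $g\in G$ is elliptic on $X$ if the orbits of $\langle g\rangle$ in $X$ are bounded; otherwise $g$ is hyperbolic on $X$ if it has exactly two fixed points on $\partial X$ and parabolic if it has exactly one. *)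

(* Defs.v *)
From HB Require Import structures.
From mathcomp Require Import all_boot all_order all_algebra.
From mathcomp Require Import all_classical all_reals all_analysis.

Set Implicit Arguments.
Unset Strict Implicit.
Unset Printing Implicit Defensive.

Import Order.TTheory GRing.Theory Num.Theory.
Import numFieldNormedType.Exports.

Local Open Scope classical_set_scope.
Local Open Scope card_scope.
Local Open Scope ring_scope.

Section HyperbolicSpaces.
Context {R : realType} {X : metricType R}.

Definition geodesic_path (x y : X) (c : R -> X) : Prop :=
  [/\ c 0 = x, c (mdist x y) = y &
      {in `[0, mdist x y] &, forall s t, mdist (c s) (c t) = `|s - t|}].

Definition geodesic_segment (x y : X) (S : set X) : Prop :=
  exists2 c, geodesic_path x y c & S = c @` `[0, mdist x y].

Definition geodesic_space : Prop :=
  forall x y : X, exists S, geodesic_segment x y S.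

Definition closed_neighborhood (delta : R) (A : set X) : set X :=
  [set p | exists2 q, A q & mdist p q <= delta].

Definition slim_triangles (delta : R) : Prop :=
  forall (x y z : X) (A B C : set X),
    geodesic_segment y z A -> geodesic_segment z x B ->
    geodesic_segment x y C ->
    [/\ A `<=` closed_neighborhood delta (B `|` C),
        B `<=` closed_neighborhood delta (C `|` A) &
        C `<=` closed_neighborhood delta (A `|` B)].

Definition gromov_hyperbolic : Prop :=
  geodesic_space /\ exists2 delta : R, 0 <= delta & slim_triangles delta.

Definition gromov_product (w x y : X) : R :=
  (mdist w x + mdist w y - mdist x y) / 2.

(* (u_m | v_n)_w --> +oo as m, n --> oo jointly. Changing w changes Gromov
   products by at most a constant, so one w or every w makes no difference. *)
Definition products_to_infinity (u v : nat -> X) : Prop :=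
  forall w : X,
    gromov_product w (u mn.1) (v mn.2) @[mn --> (\oo, \oo)] --> +oo.

Definition converges_at_infinity (u : nat -> X) : Prop :=
  products_to_infinity u u.

(* A boundary point is the set of all sequences equivalent to a given one;
   equivalence is an equivalence relation when X is Gromov-hyperbolic. *)
Definition boundary_class (u : nat -> X) : set (nat -> X) :=
  [set v | converges_at_infinity v /\ products_to_infinity u v].

Definition gromov_boundary : set (set (nat -> X)) :=
  [set boundary_class u | u in converges_at_infinity].

Definition metric_bounded (A : set X) : Prop :=
  exists M : R, forall x y, A x -> A y -> mdist x y <= M.

End HyperbolicSpaces.

Arguments geodesic_space {R} X.
Arguments slim_triangles {R} X delta.
Arguments gromov_hyperbolic {R} X.
Arguments gromov_boundary {R} X.

Section IsometricActions.
Context {R : realType} {G : groupType} {X : metricType R}.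
Variable act : G -> X -> X.

Definition isometric_action : Prop :=
  [/\ forall x, act 1%g x = x,
      forall g h x, act (g * h)%g x = act g (act h x) &
      forall g x y, mdist (act g x) (act g y) = mdist x y].

Definition limit_set (x0 : X) : set (set (nat -> X)) :=
  [set boundary_class (fun n => act (g n) x0) |
    g in [set g : nat -> G | converges_at_infinity (fun n => act (g n) x0)]].

Definition elliptic_action (x0 : X) : Prop := limit_set x0 #= `I_0.

Definition horocyclic_action (x0 : X) : Prop := limit_set x0 #= `I_1.

Definition boundary_act (g : G) (xi : set (nat -> X)) : set (nat -> X) :=
  [set (fun n => act g (u n)) | u in xi].

Definition boundary_fixed_points (g : G) : set (set (nat -> X)) :=
  [set xi | gromov_boundary X xi /\ boundary_act g xi = xi].

Definition cyclic_subgroup (g : G) : set G :=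
  [set h | exists n : nat, h = (g ^+ n)%g \/ h = (g ^- n)%g].

Definition elliptic_element (g : G) : Prop :=
  forall x, metric_bounded [set act h x | h in cyclic_subgroup g].

Definition hyperbolic_element (g : G) : Prop :=
  ~ elliptic_element g /\ boundary_fixed_points g #= `I_2.

End IsometricActions.

Definition simultaneously_hyperbolic {R : realType} {G : groupType} {l : nat}
    {X : 'I_l -> metricType R} (act : forall i, G -> X i -> X i) : set G :=
  [set g | forall i, hyperbolic_element (act i) g].

(* Main.v *)
Require Import Defs.
From mathcomp Require Import all_boot all_order all_algebra.
From mathcomp Require Import all_classical all_reals all_analysis.
From mathcomp Require Import lra zify.

Set Implicit Arguments.
Unset Strict Implicit.
Unset Printing Implicit Defensive.

Import Order.TTheory GRing.Theory Num.Theory.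

Local Open Scope classical_set_scope.
Local Open Scope ring_scope.

(** Pick for every i an element f_i that is hyperbolic on X_i. It suffices to
    find, for every i, finitely many elements theta_i(a, b) such that, for every
    u, the product u theta_i(a, b) is hyperbolic on X_i for most pairs (a, b).
    Indeed g theta_1(a_1, b_1) ... theta_l(a_l, b_l) is conjugate to
    u theta_i(a_i, b_i) where u does not involve (a_i, b_i), so a union bound
    over i provides pairs that are good for all i at once.

    If the orbits of both fixed points of f_i are infinite, take
    theta_i(a, b) = s_a f_i^k t_b with k large, where the s_a f_i^+ are distinct
    and the t_b^-1 f_i^- are distinct: at most one a brings s_a f_i^k close to
    u^-1, and for each a at most one b brings t_b^-1 f_i^-k close to
    u s_a f_i^k; otherwise u s_a f_i^k t_b moves points far compared with the
    Gromov product of its two directions. If the orbit of f_i^+ is finite (or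
    that of f_i^-, replacing f_i by its inverse), restrict to a finite-index
    subgroup fixing f_i^+ and take powers of f_i: u f_i^k is hyperbolic as soon
    as its Busemann quasi-character at f_i^+ is large, which excludes only a
    window of exponents k whose length does not depend on u. *)

(** * Gromov products *)

Section GromovProducts.
Context {R : realType} {X : metricType R}.
Implicit Types (w x y z p q : X) (d : R).

(** Gromov's inequality [(x|z) >= min ((x|y), (y|z)) - d], with the minimum unfolded into a
    disjunction. *)
Definition four_point d :=
  forall w x y z, gromov_product w x y <= gromov_product w x z + d \/
    gromov_product w y z <= gromov_product w x z + d.

Lemma gprodC w x y : gromov_product w x y = gromov_product w y x.
Proof. by rewrite /gromov_product (metric_sym x y) [mdist w x + _]addrC. Qed.

Lemma gprod_ge0 w x y : 0 <= gromov_product w x y.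
Proof.
rewrite /gromov_product; have := metric_triangle x w y.
by rewrite (metric_sym x w); lra.
Qed.

Lemma gprod_le w x y : gromov_product w x y <= mdist w x.
Proof.
rewrite /gromov_product; have := metric_triangle w x y; lra.
Qed.

Lemma gprodxx w x : gromov_product w x x = mdist w x.
Proof. by rewrite /gromov_product mdistxx; lra. Qed.

Lemma gprodwx w y : gromov_product w w y = 0.
Proof. by rewrite /gromov_product mdistxx; lra. Qed.

Lemma gprod_add w x y :
  gromov_product w x y + gromov_product x w y = mdist w x :> R.
Proof. by rewrite /gromov_product (metric_sym x w); lra. Qed.

Lemma gprod_base w w' x y :
  gromov_product w x y <= gromov_product w' x y + mdist w w'.
Proof.
rewrite /gromov_product; have := metric_triangle w w' x.
have := metric_triangle w w' y; lra.
Qed.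

Lemma gprod_point w x y y' :
  gromov_product w x y <= gromov_product w x y' + mdist y y'.
Proof.
rewrite /gromov_product; have := metric_triangle w y' y.
have := metric_triangle x y y'; rewrite (metric_sym y' y); lra.
Qed.

Lemma four_point_ge0 d (x : X) : four_point d -> 0 <= d.
Proof. by move=> /(_ x x x x); rewrite !gprodxx mdistxx; lra. Qed.

Lemma geodesic_path_dist x y (c : R -> X) s t : geodesic_path x y c ->
  0 <= s <= mdist x y -> 0 <= t <= mdist x y -> mdist (c s) (c t) = `|s - t|.
Proof. by case=> _ _ cE hs ht; apply: cE; rewrite in_itv. Qed.

Lemma gprod_le_segment w x y S p : geodesic_segment x y S -> S p ->
  gromov_product w x y <= mdist w p.
Proof.
case=> c hc -> [s]; rewrite /= in_itv /= => hs <-.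
have [c0 c1 _] := hc; have l0 := mdist_ge0 x y.
have := @geodesic_path_dist x y c 0 s hc.
have := @geodesic_path_dist x y c s (mdist x y) hc.
rewrite c0 c1 hs !lexx !l0 /= => /(_ isT isT) e1 /(_ isT isT) e2.
rewrite /gromov_product.
have := metric_triangle w (c s) x; have := metric_triangle w (c s) y.
rewrite (metric_sym (c s) x) e1 e2 sub0r normrN distrC.
rewrite !ger0_norm; [lra|lra|lra].
Qed.

(* By connectedness of [x, y], its parts near [w, x] and near [w, y] come
   within distance 1 of each other. *)
Lemma gprod_ge_segment d w x y S : geodesic_space X -> slim_triangles X d ->
  0 <= d -> geodesic_segment x y S ->
  exists2 p, S p & mdist w p <= gromov_product w x y + 2 * d + 1.
Proof.
move=> geo slim d0 hS; have [T hT] := geo y w; have [U hU] := geo w x.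
have [_ _ sub] := slim _ _ _ _ _ _ hT hU hS.
case: (hS) => c hc SE; have l0 := mdist_ge0 x y.
have nearc s : 0 <= s <= mdist x y ->
    closed_neighborhood d (T `|` U) (c s).
  by move=> hs; apply: sub; rewrite SE; exists s => //=; rewrite in_itv.
pose A := [set s | 0 <= s <= mdist x y /\ closed_neighborhood d U (c s)].
have [cu cu1 _] := hc.
have A0 : A 0.
  split; first by rewrite lexx.
  exists x; last by rewrite cu mdistxx.
  case: hU => b [b0 b1 _] ->; exists (mdist w x) => //=.
  by rewrite in_itv /= lexx mdist_ge0.
have supA : has_sup A by split; [exists 0 | exists (mdist x y) => s [/andP[]]].
(* As [s > sup A - 1], the parameter [s + 1] is outside [A], so its point is near [T]; if [s + 1]
   reaches the end of the segment, [y] itself lies on [T]. *)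
have [s [hs [q Uq sq]] ltsA] := sup_adherent (ltr01 : 0 < 1%R) supA.
have [s' hs' [q' Tq' s'q']] : exists2 s', 0 <= s' <= mdist x y /\ `|s - s'| <= 1
    & closed_neighborhood d T (c s').
  have sA : s <= sup A by apply: ub_le_sup; [case: supA | split=> //; exists q].
  have [lt1|ge1] := ltP (s + 1) (mdist x y).
    exists (s + 1); first by rewrite opprD addNKr normrN normr1; split; lra.
    have h : 0 <= s + 1 <= mdist x y by lra.
    have [q' [Tq'|Uq'] dq'] := nearc _ h; first by exists q'.
    suff : s + 1 <= sup A by lra.
    by apply: ub_le_sup; [case: supA | split=> //; exists q'].
  exists (mdist x y); first by rewrite ler_norml; lra.
  exists y; last by rewrite cu1 mdistxx.
  case: hT => b [b0 b1 _] ->; exists 0 => //=.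
  by rewrite in_itv /= lexx mdist_ge0.
exists (c s); first by rewrite SE; exists s => //=; rewrite in_itv.
have e1 := geodesic_path_dist (s := s) (t := 0) hc hs.
have e2 := geodesic_path_dist (s := s') (t := mdist x y) hc hs'.1.
have e3 := geodesic_path_dist (s := s) (t := s') hc hs hs'.1.
rewrite cu lexx l0 subr0 ger0_norm in e1; last by lra.
rewrite cu1 lexx l0 distrC ger0_norm in e2; last by lra.
move: (e1 isT) (e2 isT) => {}e1 {}e2.
have /ler_normlP[n1 n2] := hs'.2.
(* Taking [q] as base point makes the product of the endpoints at most 0: the distances from [q] to
   the two ends add up. *)
have h1 := gprod_le_segment q hU Uq; rewrite mdistxx in h1.
have h2 := gprod_le_segment q' hT Tq'; rewrite mdistxx in h2.
move: h1 h2; rewrite /gromov_product (metric_sym y w).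
have t1 := metric_triangle w q (c s); have t2 := metric_triangle (c s) q x.
have t3 := metric_triangle (c s) q' w; have t4 := metric_triangle (c s) (c s') q'.
have t5 := metric_triangle (c s') q' y.
rewrite (metric_sym (c s) w) in t3; rewrite (metric_sym w q) in t1.
rewrite (metric_sym q (c s)) in t1; lra.
Qed.

(** A point of [[z, x]] within [(x|z) + 2 * d + 1] of [w] is [d]-close to another side, and the
    distance from [w] to any point of that side bounds its product from above. *)
Lemma gromov_hyperbolic_four_point :
  gromov_hyperbolic X -> exists d, four_point d.
Proof.
case=> geo [d d0 slim]; exists (3 * d + 1) => w x y z.
have [A hA] := geo y z; have [B hB] := geo z x; have [C hC] := geo x y.
have [_ sub _] := slim _ _ _ _ _ _ hA hB hC.
have [p Bp] := gprod_ge_segment w geo slim d0 hB.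
have [q [Cq|Aq] pq] := sub _ Bp; rewrite (gprodC w z x) => wp.
- by left; have := gprod_le_segment w hC Cq; have := metric_triangle w p q; lra.
- by right; have := gprod_le_segment w hA Aq; have := metric_triangle w p q; lra.
Qed.

End GromovProducts.

(** * Sequences converging at infinity *)

Section BoundaryClasses.
Context {R : realType} {X : metricType R} (delta : R).
Hypothesis X4 : four_point (X := X) delta.
Implicit Types (u v w : nat -> X) (x : X).

Lemma products_to_infinityP x u v : products_to_infinity u v <->
  forall M, exists N, forall m n, (N <= m)%N -> (N <= n)%N ->
    M <= gromov_product x (u m) (v n).
Proof.
split=> [/(_ x)/cvgryPge h M|h w].
  have [[A B] [[N1 _ hA] [N2 _ hB]] sub] := h M.
  exists (maxn N1 N2) => m n; rewrite !geq_max => /andP[m1 _] /andP[_ n2].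
  by apply: (sub (m, n)); split; [apply: hA|apply: hB].
apply/cvgryPge => M; have [N hN] := h (M + mdist x w).
exists ([set m | (N <= m)%N], [set n | (N <= n)%N]).
  by split; exists N.
move=> [m n] [/= Nm Nn]; have := hN _ _ Nm Nn.
by have := gprod_base x w (u m) (v n); lra.
Qed.

Lemma products_to_infinityC u v :
  products_to_infinity u v -> products_to_infinity v u.
Proof.
move=> /(products_to_infinityP (u 0%N)) h.
apply/(products_to_infinityP (u 0%N)) => M; have [N hN] := h M.
by exists N => m n Nm Nn; rewrite gprodC; apply: hN.
Qed.

Lemma products_to_infinity_trans v u w : products_to_infinity u v ->
  products_to_infinity v w -> products_to_infinity u w.
Proof.
move=> /(products_to_infinityP (u 0%N)) uv /(products_to_infinityP (u 0%N)) vw.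
apply/(products_to_infinityP (u 0%N)) => M.
have [N1 h1] := uv (M + delta); have [N2 h2] := vw (M + delta).
exists (maxn N1 N2) => m n; rewrite !geq_max => /andP[m1 m2] /andP[n1 n2].
have := h1 m (maxn N1 N2) m1 (leq_maxl _ _).
have := h2 (maxn N1 N2) n (leq_maxr _ _) n2.
by have [] := X4 (u 0%N) (u m) (v (maxn N1 N2)) (w n); lra.
Qed.

Lemma boundary_class_eqP u v : converges_at_infinity u ->
  converges_at_infinity v ->
  boundary_class u = boundary_class v <-> products_to_infinity u v.
Proof.
move=> cu cv; split=> [uv|uv].
  by have [] : boundary_class u v by rewrite uv.
apply/seteqP; split=> w [cw h]; split=> //.
  exact: products_to_infinity_trans (products_to_infinityC uv) h.
exact: products_to_infinity_trans uv h.
Qed.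

Lemma converges_dist x u : converges_at_infinity u ->
  forall M, exists N, forall n, (N <= n)%N -> M <= mdist x (u n).
Proof.
move=> /(products_to_infinityP x) h M; have [N hN] := h M; exists N => n Nn.
by rewrite -(gprodxx x); apply: hN.
Qed.

(** Were the products unbounded, one would exceed the distances to all early terms, so both its
    indices are late; two four-point inequalities spread its size to all late pairs, and the classes
    coincide. *)
Lemma gprod_bounded x u v : converges_at_infinity u ->
  converges_at_infinity v -> boundary_class u <> boundary_class v ->
  exists C, forall m n, gromov_product x (u m) (v n) <= C.
Proof.
move=> cu cv; apply: contra_notP => /forallNP nb.
apply/boundary_class_eqP => //; apply/(products_to_infinityP x) => M.
move/(products_to_infinityP x): cu => /(_ (M + 2 * delta)) [N1 h1].
move/(products_to_infinityP x): cv => /(_ (M + 2 * delta)) [N2 h2].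
pose S1 := \sum_(m < N1) mdist x (u m); pose S2 := \sum_(n < N2) mdist x (v n).
have S1p : 0 <= S1 by apply: sumr_ge0 => *; apply: mdist_ge0.
have S2p : 0 <= S2 by apply: sumr_ge0 => *; apply: mdist_ge0.
have /existsNP [m /existsNP [n /negP]] := nb (S1 + S2 + `|M| + 2 * delta).
rewrite -ltNge => big; have d0 := four_point_ge0 x X4.
have absM := ler_norm M; have absM0 := normr_ge0 M.
have N1m : (N1 <= m)%N.
  rewrite leqNgt; apply/negP => mN.
  have : mdist x (u m) <= S1.
    rewrite /S1 (bigD1 (Ordinal mN)) //= lerDl.
    by apply: sumr_ge0 => *; apply: mdist_ge0.
  have := gprod_le x (u m) (v n); lra.
have N2n : (N2 <= n)%N.
  rewrite leqNgt; apply/negP => nN.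
  have : mdist x (v n) <= S2.
    rewrite /S2 (bigD1 (Ordinal nN)) //= lerDl.
    by apply: sumr_ge0 => *; apply: mdist_ge0.
  have := gprod_le x (v n) (u m); rewrite gprodC; lra.
exists (maxn N1 N2) => m' n'; rewrite !geq_max => /andP[m1 _] /andP[_ n2].
have := h1 m' m m1 N1m; have := h2 n n' N2n n2.
have := X4 x (u m') (u m) (v n'); have := X4 x (u m) (v n) (v n'); lra.
Qed.

End BoundaryClasses.

(** * Loxodromic isometries *)

Lemma fin_uniform_bound (R : realType) (I : finType) (P : I -> R -> Prop) :
  (forall i C C', C <= C' -> P i C -> P i C') -> (forall i, exists C, P i C) ->
  exists C, forall i, P i C.
Proof.
move=> mono /choice [C hC]; exists (\sum_i `|C i|) => i.
apply: mono (hC i); apply: le_trans (ler_norm _) _.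
by rewrite (bigD1 i) //= lerDl sumr_ge0.
Qed.

Section Loxodromic.
Context {R : realType} {G : groupType} {X : metricType R}.
Variables (act : G -> X -> X) (delta : R).
Hypothesis act_isometric : isometric_action act.
Hypothesis X4 : four_point (X := X) delta.
Implicit Types (g h t : G) (x y z w : X).

Let act1 x : act 1%g x = x. Proof. by have [] := act_isometric. Qed.
Let actM g h x : act (g * h)%g x = act g (act h x).
Proof. by have [] := act_isometric. Qed.
Let act_dist g x y : mdist (act g x) (act g y) = mdist x y.
Proof. by have [] := act_isometric. Qed.
Let actK g x : act g^-1%g (act g x) = x.
Proof. by rewrite -actM mulVg. Qed.
Let actVK g x : act g (act g^-1%g x) = x.
Proof. by rewrite -actM mulgV. Qed.

Lemma dist_act g x y : mdist x (act g y) = mdist (act g^-1%g x) y.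
Proof. by rewrite -(act_dist g (act _ x)) actVK. Qed.

Lemma dist_actV g x : mdist x (act g^-1%g x) = mdist x (act g x).
Proof. by rewrite dist_act invgK metric_sym. Qed.

Lemma gprod_act g x y z : gromov_product (act g x) (act g y) (act g z) =
  gromov_product x y z.
Proof. by rewrite /gromov_product !act_dist. Qed.

(** This is [gprod_add] with the product at [g x] pulled back by [g^-1]. It turns a small product
    with [g^-1 x] into closeness to [g x] after applying [g]. *)
Lemma gprod_actD g x y : gromov_product x (act g x) (act g y) +
  gromov_product x (act g^-1%g x) y = mdist x (act g x) :> R.
Proof.
by rewrite -(gprod_add x (act g x) (act g y)) -(gprod_act g x (act g^-1%g x)) actVK.
Qed.

(** Positive translation length with explicit constants; [loxodromic_hyperbolic] passes to
    [hyperbolic_element]. *)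
Definition loxodromic x g := exists e c : R, 0 < e /\ 
  forall n : nat, e * n%:R - c <= mdist x (act (g ^+ n)%g x).

Lemma loxodromic_base x y g : loxodromic x g -> loxodromic y g.
Proof.
case=> e [c [e0 gc]]; exists e, (c + 2 * mdist x y); split=> // n.
have := gc n; have := metric_triangle x y (act (g ^+ n)%g x).
have := metric_triangle y (act (g ^+ n)%g y) (act (g ^+ n)%g x).
by rewrite act_dist (metric_sym y x); lra.
Qed.

Lemma loxodromic_conj x t g : loxodromic x g -> loxodromic x (g ^ t)%g.
Proof.
move=> /(loxodromic_base (act t x)) [e [c [e0 gc]]]; exists e, c; split=> // n.
by rewrite -conjXg conjgE actM dist_act invgK actM.
Qed.

Lemma loxodromic_conjP x t g : loxodromic x (g ^ t)%g -> loxodromic x g.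
Proof. by move=> /(loxodromic_conj t^-1); rewrite conjgK. Qed.

Lemma loxodromicV x g : loxodromic x g -> loxodromic x g^-1%g.
Proof.
case=> e [c [e0 gc]]; exists e, c; split=> // n.
by rewrite expVgn dist_actV.
Qed.

Lemma loxodromic_dist x g : loxodromic x g ->
  forall M, exists N, forall n, (N <= n)%N -> M <= mdist x (act (g ^+ n)%g x).
Proof.
case=> e [c [e0 gc]] M; exists (Num.truncn ((`|M| + `|c|) / e)).+1 => n Nn.
have := gc n; have : (`|M| + `|c|) / e < n%:R.
  by apply: lt_le_trans (truncnS_gt _) _; rewrite ler_nat.
rewrite ltr_pdivrMr //; have := ler_norm M; have := ler_norm c; lra.
Qed.

(** The distance from [g^-1 x] to [g x] is that from [x] to [g^2 x]: a long square means that the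
    two directions of [g] diverge early. *)
Lemma dist_square x g : mdist x (act (g * g)%g x) =
  2 * (mdist x (act g x) - gromov_product x (act g^-1%g x) (act g x)) :> R.
Proof.
by rewrite /gromov_product -dist_act dist_actV -actM; lra.
Qed.

(** Induction: by [gprod_actD] a small product of [g^-1 x] with [g^n x] puts [g^(n+1) x] in the
    direction of [g x], away from [g^-1 x]. *)
Lemma long_square_gprod x g n :
  mdist x (act g x) + 2 * delta < mdist x (act (g * g)%g x) ->
  gromov_product x (act g^-1%g x) (act (g ^+ n)%g x) <=
  gromov_product x (act g^-1%g x) (act g x) + delta.
Proof.
move=> long; have d0 := four_point_ge0 x X4.
elim: n => [|n IH].
  rewrite expg0 act1 gprodC gprodwx.
  by have := gprod_ge0 x (act g^-1%g x) (act g x); lra.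
have := gprod_actD g x (act (g ^+ n)%g x); rewrite -actM -expgS => h.
have P := dist_square x g.
have := X4 x (act g^-1%g x) (act (g ^+ n.+1)%g x) (act g x).
by rewrite (gprodC x (act (g ^+ n.+1)%g x)); lra.
Qed.

(** By the previous bound, each further power adds at least the excess [e] to the displacement. *)
Lemma long_square_loxodromic x g :
  mdist x (act g x) + 2 * delta < mdist x (act (g * g)%g x) -> loxodromic x g.
Proof.
move=> long; have d0 := four_point_ge0 x X4.
pose e := mdist x (act (g * g)%g x) - mdist x (act g x) - 2 * delta.
exists e, 0; split; first by rewrite /e; lra.
elim=> [|n IH]; first by rewrite mulr0 subrr mdist_ge0.
have eq_next : 2 * gromov_product x (act g^-1%g x) (act (g ^+ n)%g x) =
    mdist x (act g x) + mdist x (act (g ^+ n)%g x) -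
    mdist x (act (g ^+ n.+1)%g x) :> R.
  by rewrite /gromov_product dist_actV -dist_act -actM -expgS; lra.
have := dist_square x g; have := long_square_gprod n long.
rewrite -natr1; move: IH; rewrite /e; lra.
Qed.

(** The third [delta] of slack pays for one more four-point step, combining the one-sided bounds for
    [g] and [g^-1]. *)
Lemma very_long_square_gprod x g :
  mdist x (act g x) + 3 * delta < mdist x (act (g * g)%g x) ->
  forall m n, gromov_product x (act (g ^- m)%g x) (act (g ^+ n)%g x) <=
    gromov_product x (act g^-1%g x) (act g x) + 2 * delta.
Proof.
have d0 := four_point_ge0 x X4.
move=> long [|m] n.
  rewrite invg1 act1 gprodwx.
  by have := gprod_ge0 x (act g^-1%g x) (act g x); lra.
have long2 : mdist x (act g x) + 2 * delta < mdist x (act (g * g)%g x) by lra.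
have longV : mdist x (act g^-1%g x) + 2 * delta <
    mdist x (act (g^-1 * g^-1)%g x) by rewrite -invgM !dist_actV.
have hn := long_square_gprod n long2; have hm := long_square_gprod m longV.
have := gprod_actD g^-1%g x (act (g^-1 ^+ m)%g x).
rewrite -actM -expgS dist_actV => hd.
rewrite invgK in hm hd; rewrite (gprodC x (act g x) (act g^-1%g x)) in hm.
have P := dist_square x g; rewrite -expVgn.
have := X4 x (act g^-1%g x) (act (g^-1 ^+ m.+1)%g x) (act (g ^+ n)%g x).
lra.
Qed.

Lemma dist_expg x g n : mdist x (act (g ^+ n)%g x) <= mdist x (act g x) *+ n.
Proof.
elim: n => [|n IH]; first by rewrite expg0 act1 mdistxx.
rewrite expgSr actM mulrSr; have := metric_triangle x (act (g ^+ n)%g x)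
  (act (g ^+ n)%g (act g x)); rewrite act_dist; lra.
Qed.

(* Otherwise |g^(2^i)| would grow at most linearly in i. *)
Lemma loxodromic_long_power x g : loxodromic x g ->
  exists2 j, (0 < j)%N & mdist x (act (g ^+ j)%g x) + 3 * delta <
    mdist x (act (g ^+ j * g ^+ j)%g x).
Proof.
case=> e [c [e0 gc]]; have d0 := four_point_ge0 x X4.
apply: contrapT => /forall2NP no.
have le_dist i : mdist x (act (g ^+ (2 ^ i))%g x) <=
    mdist x (act g x) + 3 * delta * i%:R.
  elim: i => [|i IH]; first by rewrite expg1 mulr0 addr0.
  have [] := no (2 ^ i)%N; first by rewrite expn_gt0.
  move=> /negP; rewrite -leNgt -expgnDr addnn -mul2n -expnS -natr1; lra.
have pow_ge i : (i.+1 * i.+1 <= 2 ^ (i + i))%N.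
  by rewrite expnD leq_mul // ltn_expl.
(* At exponent [2 ^ (i + i)] the lower bound is at least [e * (i+1)^2 - c], the upper bound linear
   in [i]; [A] collects the linear coefficients. *)
pose A := mdist x (act g x) + `|c| + 6 * delta.
have A0 : 0 <= A.
  by have := mdist_ge0 x (act g x); have := normr_ge0 c; rewrite /A; lra.
pose i := Num.truncn (A / e).
have i_gt : A < e * i.+1%:R by rewrite mulrC -ltr_pdivrMr // truncnS_gt.
have : e * (i.+1%:R * i.+1%:R) <= e * (2 ^ (i + i))%:R.
  by rewrite ler_wpM2l ?(ltW e0) // -natrM ler_nat.
have := le_dist (i + i)%N; have := gc (2 ^ (i + i))%N.
have n1 : 1 <= i.+1%:R :> R by rewrite ler1n.
have : (i + i)%:R = i.+1%:R * 2 - 2 :> R by rewrite natrD -natr1; lra.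
have At : A * i.+1%:R < e * i.+1%:R * i.+1%:R by rewrite ltr_pM2r // ltr0n.
have DC : mdist x (act g x) + `|c| <= (mdist x (act g x) + `|c|) * i.+1%:R.
  by apply: ler_peMr => //; rewrite addr_ge0 ?mdist_ge0.
have := ler_norm c; move: At DC; rewrite /A.
move: (mdist _ _) (i.+1%:R) ((i + i)%:R) => D t s At DC c_le -> ge le h.
have : 0 <= delta by []; lra.
Qed.

(** Some power [g ^+ j] satisfies the two-sided bound, and exponents modulo [j] displace [x] by a
    bounded amount. *)
Lemma loxodromic_gprod_bounded x g : loxodromic x g ->
  exists C, forall m n,
    gromov_product x (act (g ^- m)%g x) (act (g ^+ n)%g x) <= C.
Proof.
move=> /loxodromic_long_power [j j0 long].
have hC := very_long_square_gprod long; set C := gromov_product _ _ _ + _ in hC.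
have rem_le r : (r < j)%N ->
    mdist x (act (g ^+ r)%g x) <= mdist x (act g x) *+ j.
  move=> rj; apply: le_trans (dist_expg x g r) _.
  by rewrite ler_wpMn2l ?mdist_ge0 // ltnW.
exists (C + mdist x (act g x) *+ j *+ 2) => m n.
have h1 := rem_le _ (ltn_pmod m j0); have h2 := rem_le _ (ltn_pmod n j0).
have hm : mdist (act (g ^- m)%g x) (act (g ^+ j ^- (m %/ j))%g x) <=
    mdist x (act g x) *+ j.
  rewrite -expgnA mulnC {1}(divn_eq m j) addnC expgnDr invgM actM act_dist.
  by rewrite metric_sym dist_actV.
have hn : mdist (act (g ^+ n)%g x) (act (g ^+ j ^+ (n %/ j))%g x) <=
    mdist x (act g x) *+ j.
  rewrite -expgnA mulnC {1}(divn_eq n j) expgnDr actM act_dist.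
  by rewrite metric_sym.
have := hC (m %/ j)%N (n %/ j)%N.
have := gprod_point x (act (g ^- m)%g x) (act (g ^+ n)%g x)
  (act (g ^+ j ^+ (n %/ j))%g x).
have := gprod_point x (act (g ^+ j ^+ (n %/ j))%g x) (act (g ^- m)%g x)
  (act (g ^+ j ^- (m %/ j))%g x).
rewrite mulr2n !(gprodC x (act (g ^+ j ^+ (n %/ j))%g x)); lra.
Qed.


(** * Attracting points and fixed points at infinity *)

(** The repelling point of [g] is written [attracting x g^-1]. *)
Definition attracting x g := boundary_class (fun n => act (g ^+ n)%g x).

(** For [m <= n] the product of [g^m x] and [g^n x] is the displacement of [g^m], which diverges,
    minus a bounded product of [g^-m x] and [g^(n-m) x]. *)
Lemma loxodromic_converges x g : loxodromic x g ->
  converges_at_infinity (fun n => act (g ^+ n)%g x).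
Proof.
move=> lox; apply/(products_to_infinityP x) => M.
have [C hC] := loxodromic_gprod_bounded lox.
have [N hN] := loxodromic_dist lox (M + C).
have wlog_le m n : (N <= m)%N -> (m <= n)%N ->
    M <= gromov_product x (act (g ^+ m)%g x) (act (g ^+ n)%g x).
  move=> Nm mn; have := gprod_actD (g ^+ m)%g x (act (g ^+ (n - m))%g x).
  rewrite -actM -expgnDr subnKC //.
  by have := hC m (n - m)%N; have := hN m Nm; lra.
exists N => m n Nm Nn; have [mn|/ltnW nm] := leqP m n; first exact: wlog_le.
by rewrite gprodC; apply: wlog_le.
Qed.

Lemma attracting_neq x g : loxodromic x g ->
  attracting x g <> attracting x g^-1%g.
Proof.
move=> lox; have [C hC] := loxodromic_gprod_bounded lox.
have cg := loxodromic_converges lox.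
have cV := loxodromic_converges (loxodromicV lox).
move/(boundary_class_eqP X4 cg cV)/(products_to_infinityP x) => /(_ (C + 1)).
case=> N /(_ N N (leqnn N) (leqnn N)); rewrite gprodC expVgn.
by have := hC N N; lra.
Qed.

Lemma products_to_infinity_act g (u v : nat -> X) : products_to_infinity u v ->
  products_to_infinity (fun n => act g (u n)) (fun n => act g (v n)).
Proof.
move=> /(products_to_infinityP (u 0%N)) h.
apply/(products_to_infinityP (act g (u 0%N))) => M; have [N hN] := h M.
by exists N => m n Nm Nn; rewrite gprod_act; apply: hN.
Qed.

Lemma boundary_act1 xi : boundary_act act 1%g xi = xi.
Proof.
have id u : (fun n => act 1%g (u n)) = u by apply/funext => n; rewrite act1.
rewrite /boundary_act; apply/seteqP; split=> [_ [u xiu <-]|u xiu].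
  by rewrite id.
by exists u => //; rewrite id.
Qed.

Lemma boundary_actM g h xi :
  boundary_act act (g * h)%g xi = boundary_act act g (boundary_act act h xi).
Proof.
apply/seteqP; split=> [_ [u xiu <-]|_ [_ [u xiu <-] <-]].
  exists (fun n => act h (u n)); first by exists u.
  by apply/funext => n; rewrite actM.
by exists u => //; apply/funext => n; rewrite actM.
Qed.

Lemma boundary_actK g : cancel (boundary_act act g) (boundary_act act g^-1%g).
Proof. by move=> xi; rewrite -boundary_actM mulVg boundary_act1. Qed.

Lemma boundary_actX g n xi : boundary_act act g xi = xi ->
  boundary_act act (g ^+ n)%g xi = xi.
Proof.
move=> fix_xi; elim: n => [|n IH]; first by rewrite expg0 boundary_act1.
by rewrite expgS boundary_actM IH.
Qed.

Lemma boundary_act_class g u : boundary_act act g (boundary_class u) =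
  boundary_class (fun n => act g (u n)).
Proof.
have sub h v : boundary_act act h (boundary_class v) `<=`
    boundary_class (fun n => act h (v n)).
  move=> _ [w [cw vw] <-].
  by split; [exact: products_to_infinity_act|exact: products_to_infinity_act].
apply/seteqP; split; first exact: sub.
(* The reverse inclusion is the first one applied to [g^-1]. *)
rewrite -[X in X `<=` _](boundary_actK g^-1%g) invgK.
apply: image_subset => w /sub.
by under [X in boundary_class X]eq_fun do rewrite actK.
Qed.

Lemma attracting_fixed x g : loxodromic x g ->
  boundary_act act g (attracting x g) = attracting x g.
Proof.
move=> lox; have cg := loxodromic_converges lox.
rewrite boundary_act_class; apply/(boundary_class_eqP X4) => //.
  exact: products_to_infinity_act.
apply/(products_to_infinityP x) => M.
have [N hN] := (products_to_infinityP x _ _).1 cg M.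
exists N => m n Nm Nn; rewrite -actM -expgS.
by apply: hN => //; rewrite (leq_trans Nm).
Qed.

Lemma attractingV_fixed x g : loxodromic x g ->
  boundary_act act g (attracting x g^-1%g) = attracting x g^-1%g.
Proof.
move=> /loxodromicV /attracting_fixed {1}<-.
by rewrite -{1}[g]invgK boundary_actK.
Qed.

(** North-south dynamics: a sequence away from both points is pushed by a large power [g^j] towards
    [g^j x], hence away from itself. *)
Lemma fixed_point_attracting x g xi : loxodromic x g ->
  gromov_boundary X xi -> boundary_act act g xi = xi ->
  xi = attracting x g \/ xi = attracting x g^-1%g.
Proof.
move=> lox [w cw <-] fix_w; apply: contrapT => /not_orP [neq neqV].
have cg := loxodromic_converges lox.
have cV := loxodromic_converges (loxodromicV lox).
have [C1 h1] := gprod_bounded X4 x cw cg neq.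
have [C2 h2] := gprod_bounded X4 x cw cV neqV.
have [j hj] := loxodromic_dist lox (C1 + C2 + delta + 1).
have : boundary_class w (fun n => act (g ^+ j)%g (w n)).
  by rewrite -(boundary_actX j fix_w); exists w.
case=> _ /(products_to_infinityP x) /(_ (C1 + delta + 1)) [N].
move=> /(_ N N (leqnn N) (leqnn N)).
have := gprod_actD (g ^+ j)%g x (w N); have := hj j (leqnn j).
have := h2 N j; rewrite expVgn (gprodC x (w N)); have := h1 N j.
have := X4 x (w N) (act (g ^+ j)%g (w N)) (act (g ^+ j)%g x).
by rewrite (gprodC x (act (g ^+ j)%g (w N))); lra.
Qed.

Lemma loxodromic_hyperbolic x g : loxodromic x g -> hyperbolic_element act g.
Proof.
move=> lox; split.
  move=> /(_ x) [M hM]; have [n hn] := loxodromic_dist lox (M + 1).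
  have := hn n (leqnn n); have := hM x (act (g ^+ n)%g x).
  have in1 : [set act h x | h in cyclic_subgroup g] x.
    by exists 1%g; [exists 0%N; left|rewrite act1].
  have inn : [set act h x | h in cyclic_subgroup g] (act (g ^+ n)%g x).
    by exists (g ^+ n)%g => //; exists n; left.
  move=> /(_ in1 inn); lra.
have fix1 : boundary_fixed_points act g (attracting x g).
  split; last exact: attracting_fixed.
  by exists (fun n => act (g ^+ n)%g x) => //; apply: loxodromic_converges.
have fix2 : boundary_fixed_points act g (attracting x g^-1%g).
  split; last exact: attractingV_fixed.
  exists (fun n => act (g^-1 ^+ n)%g x) => //.
  exact/loxodromic_converges/loxodromicV.
apply/eq_cardSP; exists (attracting x g) => //.
suff -> : boundary_fixed_points act g `\ attracting x g =
    [set attracting x g^-1%g] by apply: card_set1.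
apply/seteqP; split=> [xi [[bxi fxi] /= neq]|_ ->].
  by have [] := fixed_point_attracting lox bxi fxi.
by split=> // /esym; apply: attracting_neq.
Qed.

Lemma not_loxodromic_square x g : ~ loxodromic x g ->
  mdist x (act (g * g)%g x) <= mdist x (act g x) + 2 * delta.
Proof. by apply: contra_notT; rewrite -ltNge => /long_square_loxodromic. Qed.

(* Elements g and h pushing x far towards two distinct limit points are
   loxodromic, or else their inverses push x the same way and gh is loxodromic. *)
Lemma exists_loxodromic x : ~ elliptic_action act x ->
  ~ horocyclic_action act x -> exists g, loxodromic x g.
Proof.
rewrite /elliptic_action /horocyclic_action => nE nH.
have [xi Lxi] : limit_set act x !=set0.
  by apply/set0P; apply: contra_notN nE => /eqP ->; rewrite II0 card_eq00.
have [eta Leta neq] : exists2 eta, limit_set act x eta & xi <> eta.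
  apply: contra_notP nH => /forall2NP no.
  suff -> : limit_set act x = [set xi] by apply: card_set1.
  apply/seteqP; split=> [z Lz|_ -> //]; have [//|] := no z.
  by move=> /contrapT ->.
case: Lxi Leta neq => g cg <- [h ch <-] neq {xi eta nE nH}.
have [C hC] := gprod_bounded X4 x cg ch neq.
have d0 := four_point_ge0 x X4.
have C0 : 0 <= C := le_trans (gprod_ge0 x _ _) (hC 0%N 0%N).
apply: contrapT => /forallNP nolox.
have [N1 /(_ N1 (leqnn _)) h1] := converges_dist x cg (3 * C + 20 * delta + 1).
have [N2 /(_ N2 (leqnn _)) h2] := converges_dist x ch (3 * C + 20 * delta + 1).
move: (hC N1 N2) h1 h2; move: (g N1) (h N2) => {}g {}h {cg ch neq hC N1 N2}.
move=> gh_le g_ge h_ge.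
(* If [k] is not loxodromic, [k x] and [k^-1 x] share a direction along about half of the
   displacement. *)
have far k : 2 * gromov_product x (act k^-1%g x) (act k x) >=
    mdist x (act k x) - 2 * delta.
  by have := not_loxodromic_square (nolox k); have := dist_square x k; lra.
have Vg_h : gromov_product x (act g^-1%g x) (act h x) <= C + delta.
  have := X4 x (act g x) (act g^-1%g x) (act h x).
  by rewrite (gprodC x (act g x) (act g^-1%g x)); have := far g; lra.
have Vh_g : gromov_product x (act h^-1%g x) (act g x) <= C + delta.
  have := X4 x (act h x) (act h^-1%g x) (act g x).
  rewrite (gprodC x (act h x)) (gprodC x (act h x) (act g x)).
  by have := far h; lra.
(* So [g h x] leaves [x] along [g x] and its inverse image along [h^-1 x]; these directions diverge
   early, against [far] for [g h]. *)
have := gprod_actD g x (act h x); rewrite -actM => near_g.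
have := gprod_actD h^-1%g x (act g^-1%g x).
rewrite -actM invgK dist_actV (gprodC x (act h x)) -invgM => near_h.
have h1 := X4 x (act g x) (act (g * h)%g x) (act h^-1%g x).
have h2 := X4 x (act h^-1%g x) (act (g * h)^-1%g x) (act (g * h)%g x).
rewrite (gprodC x (act (g * h)%g x)) (gprodC x (act g x) (act h^-1%g x)) in h1.
have := gprod_le x (act (g * h)%g x) (act g x).
rewrite (gprodC x _ (act g x)); have := far (g * h)%g; lra.
Qed.

(** * Busemann cocycles at an attracting point *)

(** Busemann functions are defined up to [2 * delta]: the difference of distances is [mdist x y]
    minus twice the product of [y] and [u m] at [x], which four points pin down up to [delta]. *)
Lemma busemann_close x y (u v : nat -> X) : products_to_infinity u v ->
  exists N, forall m n, (N <= m)%N -> (N <= n)%N ->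
  `|(mdist y (u m) - mdist x (u m)) - (mdist y (v n) - mdist x (v n))|
    <= 2 * delta.
Proof.
move=> /(products_to_infinityP x) /(_ (mdist x y + delta + 1)) [N hN].
exists N => m n Nm Nn; have huv := hN m n Nm Nn.
have d0 := four_point_ge0 x X4.
have h1 := X4 x (u m) (v n) y; have h2 := X4 x (v n) (u m) y.
have := gprod_le x y (u m); have := gprod_le x y (v n).
rewrite !(gprodC x y) => yv yu; rewrite (gprodC x (v n) (u m)) in h2.
have : `|gromov_product x (u m) y - gromov_product x (v n) y| <= delta.
  by rewrite ler_norml; apply/andP; split; lra.
rewrite /gromov_product (metric_sym (u m)) (metric_sym (v n)) !ler_norml.
by move=> /andP[? ?]; apply/andP; split; lra.
Qed.

Lemma attracting_fixedV x f h : loxodromic x f ->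
  boundary_act act h (attracting x f) = attracting x f ->
  products_to_infinity (fun n => act (f ^+ n)%g x)
    (fun n => act h^-1%g (act (f ^+ n)%g x)).
Proof.
move=> lox fix_h; have cf := loxodromic_converges lox.
apply/(boundary_class_eqP X4) => //; first exact: products_to_infinity_act.
by rewrite -boundary_act_class -{2}[boundary_class _]fix_h boundary_actK.
Qed.

(* If h fixes the attracting point of f, the Busemann cocycle at that point
   grows linearly along the powers of h as soon as it is large at h. *)
Lemma busemann_loxodromic x f h r N : loxodromic x f ->
  boundary_act act h (attracting x f) = attracting x f ->
  (forall n, (N <= n)%N ->
    `|mdist (act h x) (act (f ^+ n)%g x) - mdist x (act (f ^+ n)%g x) - r|
    <= 2 * delta) ->
  6 * delta < `|r| -> loxodromic x h.
Proof.
move=> lox fix_h close r_large; have d0 := four_point_ge0 x X4.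
pose b g n : R := mdist (act g x) (act (f ^+ n)%g x) - mdist x (act (f ^+ n)%g x).
(* Replacing [f^n x] by [h^-1 f^n x] costs [2 * delta] and [close] costs [2 * delta], so each power
   adds [r] within the allowance [6 * delta]. *)
have power j : exists N, forall n, (N <= n)%N ->
    `|b (h ^+ j)%g n - j%:R * r| <= 6 * delta * j%:R.
  elim: j => [|j [N1 IH]].
    exists 0%N => n _.
    by rewrite /b expg0 act1 subrr mul0r subr0 normr0 mulr0.
  have [N2 h2] := busemann_close x (act (h ^+ j)%g x) (attracting_fixedV lox fix_h).
  exists (maxn N (maxn N1 N2)) => n; rewrite !geq_max => /and3P[Nn N1n N2n].
  have := h2 n n N2n N2n; have := IH n N1n; have := close n Nn.
  rewrite /b !(dist_act h^-1%g) invgK -actM -expgS.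
  rewrite -natr1 !ler_norml.
  by move=> /andP[? ?] /andP[? ?] /andP[? ?]; apply/andP; split; lra.
exists (`|r| - 6 * delta), 0; split; first by rewrite subr_gt0.
move=> j; have [n hn] := power j; have := hn n (leqnn n).
have : `|b (h ^+ j)%g n| <= mdist x (act (h ^+ j)%g x).
  have := metric_triangle x (act (h ^+ j)%g x) (act (f ^+ n)%g x).
  have := metric_triangle (act (h ^+ j)%g x) x (act (f ^+ n)%g x).
  rewrite (metric_sym _ x) /b ler_norml => ? ?; apply/andP; split; lra.
have := ler_normB (b (h ^+ j)%g n) (b (h ^+ j)%g n - j%:R * r).
rewrite subKr normrM normr_nat; lra.
Qed.

(** The value at a late index [N] serves as [r]: it is at most [6 * delta] in size, and other late
    indices differ from it by [2 * delta]. *)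
Lemma busemann_not_loxodromic x f h : loxodromic x f ->
  boundary_act act h (attracting x f) = attracting x f -> ~ loxodromic x h ->
  exists N, forall n, (N <= n)%N ->
    `|mdist (act h x) (act (f ^+ n)%g x) - mdist x (act (f ^+ n)%g x)|
    <= 8 * delta.
Proof.
move=> lox fix_h nlox.
have [N hN] := busemann_close x (act h x) (loxodromic_converges lox).
exists N => n Nn; have := hN n N Nn (leqnn N).
set r := (X in _ - X); have : `|r| <= 6 * delta.
  rewrite leNgt; apply/negP => r_large; apply: nlox.
  apply: (busemann_loxodromic (N := N) lox fix_h _ r_large) => m Nm.
  exact: hN Nm (leqnn N).
rewrite !ler_norml => /andP[? ?] /andP[? ?]; apply/andP; split; lra.
Qed.

(** If both products fail to be loxodromic, both Busemann values are near 0, yet they differ by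
    about the displacement of [f^(k'-k)]. The contribution of [u] cancels, so [K] is uniform. *)
Lemma fixing_loxodromic_window x f : loxodromic x f -> exists K, forall u,
  boundary_act act u (attracting x f) = attracting x f ->
  forall k k', ~ loxodromic x (u * f ^+ k)%g -> ~ loxodromic x (u * f ^+ k')%g ->
  (k' < k + K)%N.
Proof.
move=> lox; have [C hC] := loxodromic_gprod_bounded lox.
(* Two Busemann values of size [8 * delta], two exchanges of [u^-1 f^n x] for [f^n x] at [2 * delta]
   each, and [2 * C] for the defect of additivity in [gap]. *)
have [K hK] := loxodromic_dist lox (20 * delta + 2 * C + 1).
exists K => u fix_u k k' nk nk'; rewrite ltnNge; apply/negP => le_kk'.
have fixk j : boundary_act act (u * f ^+ j)%g (attracting x f) = attracting x f.
  by rewrite boundary_actM boundary_actX //; apply: attracting_fixed.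
have [N1 h1] := busemann_not_loxodromic lox (fixk k) nk.
have [N2 h2] := busemann_not_loxodromic lox (fixk k') nk'.
have Vu := attracting_fixedV lox fix_u.
have [N3 h3] := busemann_close x (act (f ^+ k)%g x) Vu.
have [N4 h4] := busemann_close x (act (f ^+ k')%g x) Vu.
pose n := maxn k' (maxn (maxn N1 N2) (maxn N3 N4)).
have : (n <= n)%N by [].
rewrite {1}/n !geq_max => /and3P[k'n /andP[N1n N2n] /andP[N3n N4n]].
have kn : (k <= n)%N by rewrite (leq_trans _ k'n) // (leq_trans _ le_kk') ?leq_addr.
have := h4 n n N4n N4n; have := h3 n n N3n N3n.
have := h2 n N2n; have := h1 n N1n; rewrite !actM.
have actl g y z : mdist (act g y) z = mdist y (act g^-1%g z).
  by rewrite [LHS]metric_sym [LHS]dist_act [LHS]metric_sym.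
rewrite !(actl u).
have shift i : (i <= n)%N ->
    mdist (act (f ^+ i)%g x) (act (f ^+ n)%g x) = mdist x (act (f ^+ (n - i))%g x).
  by move=> le_in; rewrite -{1}(subnKC le_in) expgnDr actM act_dist.
rewrite !shift //.
have gap : mdist x (act (f ^+ (n - k))%g x) >=
    mdist x (act (f ^+ (k' - k))%g x) + mdist x (act (f ^+ (n - k'))%g x) - 2 * C.
  have := hC (k' - k)%N (n - k')%N.
  rewrite /gromov_product dist_actV -dist_act -actM -expgnDr.
  have -> : (k' - k + (n - k') = n - k)%N by lia.
  lra.
have := hK (k' - k)%N; rewrite leq_subRL; last by lia.
move=> /(_ le_kk') far.
move: far gap; clear; rewrite !ler_norml.
by move=> far gap /andP[? ?] /andP[? ?] /andP[? ?] /andP[? ?]; lra.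
Qed.

(** * Families whose products are mostly loxodromic *)

Lemma translates_gprod_bounded x f M (s : 'I_M -> G) : loxodromic x f ->
  injective (fun a => boundary_act act (s a) (attracting x f)) ->
  exists C, forall a a' m n, a <> a' -> gromov_product x
    (act (s a) (act (f ^+ m)%g x)) (act (s a') (act (f ^+ n)%g x)) <= C.
Proof.
move=> lox inj_s; have cf := loxodromic_converges lox.
have [|aa'|C hC] := @fin_uniform_bound R ('I_M * 'I_M)%type (fun aa' C =>
    forall m n, aa'.1 <> aa'.2 -> gromov_product x (act (s aa'.1)
      (act (f ^+ m)%g x)) (act (s aa'.2) (act (f ^+ n)%g x)) <= C).
- by move=> aa' C C' le_C hC m n neq; apply: le_trans (hC m n neq) le_C.
- have [eq_aa'|/eqP neq] := eqVneq aa'.1 aa'.2; first by exists 0 => m n [].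
  have [|C hC] := gprod_bounded X4 x (products_to_infinity_act (s aa'.1) cf)
    (products_to_infinity_act (s aa'.2) cf); last by exists C.
  by rewrite -!boundary_act_class => /inj_s.
- by exists C => a a' m n; apply: (hC (a, a')).
Qed.

(** Two translates close to the same [y] would be close to each other, against the uniform bound for
    distinct limit points. *)
Lemma translates_close x f M (s : 'I_M -> G) : loxodromic x f ->
  injective (fun a => boundary_act act (s a) (attracting x f)) ->
  exists C, forall y n a a',
    C < gromov_product x (act (s a) (act (f ^+ n)%g x)) y ->
    C < gromov_product x (act (s a') (act (f ^+ n)%g x)) y -> a = a'.
Proof.
move=> lox inj_s; have [C hC] := translates_gprod_bounded lox inj_s.
exists (C + delta) => y n a a' big big'; apply/eqP; apply: contraT => /eqP neq.
have := hC a a' n n neq.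
have := X4 x (act (s a) (act (f ^+ n)%g x)) y (act (s a') (act (f ^+ n)%g x)).
rewrite (gprodC x y); lra.
Qed.

(* R1 and R2 are the exceptional pairs: R1 excludes at most one a for each b,
   and R2 at most one b for each a. *)
Definition mostly_loxodromic x M (u : G) (theta : 'I_M -> 'I_M -> G) :=
  exists R1 R2 : 'I_M -> 'I_M -> Prop,
  [/\ forall a a' b, R1 a b -> R1 a' b -> a = a',
      forall a b b', R2 a b -> R2 a b' -> b = b' &
      forall a b, ~ R1 a b -> ~ R2 a b -> loxodromic x (u * theta a b)%g].

Lemma translates_mostly_loxodromic x f M (s t : 'I_M -> G) : loxodromic x f ->
  injective (fun a => boundary_act act (s a) (attracting x f)) ->
  injective (fun b => boundary_act act (t b)^-1%g (attracting x f^-1%g)) ->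
  exists K, forall k, (K <= k)%N -> forall u,
    mostly_loxodromic x u (fun a b => s a * f ^+ k * t b)%g.
Proof.
move=> lox inj_s inj_t.
have [C1 h1] := translates_close lox inj_s.
have [C2 h2] := translates_close (loxodromicV lox) inj_t.
have mono (v : 'I_M -> G) a A A' : A <= A' -> mdist x (act (v a) x) <= A ->
    mdist x (act (v a) x) <= A' by move=> AA' vA; apply: le_trans vA AA'.
have bound (v : 'I_M -> G) : exists A, forall a, mdist x (act (v a) x) <= A.
  by apply: (fin_uniform_bound (mono v)) => a; exists (mdist x (act (v a) x)).
have [A1 hA1] := bound s; have [A2 hA2] := bound t.
(* [A1] and [A2] pay for moving [s a] and [t b] between base points and arguments of products. *)
pose E1 := C1 + A1 + A2; pose E2 := C2 + A2.
have [K hK] := loxodromic_dist lox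
  (`|E1| + 2 * `|E2| + 10 * delta + 1 + `|E1| + `|E2|).
exists K => k Kk u; have := hK k Kk => long {hK}.
exists (fun a b => C1 < gromov_product x (act (s a) (act (f ^+ k)%g x))
  (act u^-1%g x)).
exists (fun a b => C2 < gromov_product x
  (act (t b)^-1%g (act (f^-1 ^+ k)%g x)) (act (u * s a * f ^+ k)%g x)).
split=> [a a' _|a b b'|a b /negP]; [exact: h1|exact: h2|].
rewrite -leNgt => near1 /negP; rewrite -leNgt => near2.
(* The conjugate ends in [f^k], so its inverse moves [x] along [f^-k x] by [le1], while it moves [x]
   away from there by [le2]; its square is long. *)
apply: (@loxodromic_conjP _ (t b)^-1%g); apply: long_square_loxodromic.
have -> : ((u * (s a * f ^+ k * t b)) ^ (t b)^-1 = t b * u * s a * f ^+ k)%g.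
  by rewrite conjgE invgK !mulgA mulgK.
have [h eh] : exists h, h = (t b * u * s a * f ^+ k)%g by eexists.
rewrite -eh.
have d0 := four_point_ge0 x X4.
have [sA tA] := (hA1 a, hA2 b).
have le1 : gromov_product x (act (f ^+ k)%g x)
    (act (s a)^-1%g (act u^-1%g (act (t b)^-1%g x))) <= E1.
  rewrite -(gprod_act (s a)) actVK.
  have := gprod_base (act (s a) x) x (act (s a) (act (f ^+ k)%g x))
    (act u^-1%g (act (t b)^-1%g x)).
  have := gprod_point x (act (s a) (act (f ^+ k)%g x))
    (act u^-1%g (act (t b)^-1%g x)) (act u^-1%g x).
  rewrite act_dist (metric_sym _ x) dist_actV (metric_sym _ x).
  rewrite /E1; lra.
have le2 : gromov_product x (act h x) (act (f^-1 ^+ k)%g x) <= E2.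
  rewrite -(gprod_act (t b)^-1%g).
  have := gprod_base (act (t b)^-1%g x) x (act (t b)^-1%g (act h x))
    (act (t b)^-1%g (act (f^-1 ^+ k)%g x)).
  have -> : act (t b)^-1%g (act h x) = act (u * s a * f ^+ k)%g x.
    by rewrite -actM eh -!mulgA mulKg.
  rewrite (metric_sym _ x) dist_actV (gprodC x) /E2; lra.
have := gprod_actD (f^-1 ^+ k)%g x (act (s a)^-1%g (act u^-1%g (act (t b)^-1%g x))).
rewrite expVgn invgK dist_actV -!actM -!invgM !mulgA -eh => sum.
rewrite expVgn in le2; rewrite -!actM -!invgM mulgA in le1.
have := X4 x (act (f ^- k)%g x) (act h^-1%g x) (act h x).
have := gprod_le x (act h^-1%g x) (act (f ^- k)%g x).
have := dist_square x h; rewrite dist_actV.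
rewrite (gprodC x (act (f ^- k)%g x)) in sum.
rewrite (gprodC x (act (f ^- k)%g x) (act h x)).
rewrite (gprodC x (act (f ^- k)%g x) (act h^-1%g x)).
have := ler_norm E1; have := ler_norm E2.
have := normr_ge0 E1; have := normr_ge0 E2.
move: long le1 sum le2 d0; clear; lra.
Qed.

(** The exponents are spaced wider than the window, so at most one [a] fails. The factor [m] serves
    to keep the powers in a finite-index subgroup. *)
Lemma fixing_mostly_loxodromic x f M m : (0 < m)%N -> loxodromic x f ->
  exists K, forall u, boundary_act act u (attracting x f) = attracting x f ->
    mostly_loxodromic x u (fun a _ : 'I_M => f ^+ (m * K * a))%g.
Proof.
move=> m0 lox; have [K hK] := fixing_loxodromic_window lox.
exists K.+1 => u fix_u.
exists (fun a _ => ~ loxodromic x (u * f ^+ (m * K.+1 * a))%g), (fun _ _ => False).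
split=> // [a a' _ na na'|a b /contrapT //].
have le_of_window i j : (m * K.+1 * i < m * K.+1 * j + K)%N -> (i <= j)%N.
  move=> close; rewrite leqNgt; apply/negP => ji.
  have := leq_mul (leqnn (m * K.+1)) ji; have := leq_pmull K.+1 m0.
  by rewrite mulnS; lia.
apply/val_inj/eqP; rewrite eqn_leq (le_of_window _ _ (hK u fix_u _ _ na' na)).
exact: le_of_window (hK u fix_u _ _ na na').
Qed.

End Loxodromic.

(** * Finite-index subgroups and counting *)

(** The colour records all values [phi i g] at once, coded by ordinals; later its classes refine the
    cosets of a stabilizer. *)
Lemma finite_ranges_coloring (G : Type) (I : finType) (Y : I -> Type)
    (phi : forall i, G -> Y i) : (forall i, finite_set (range (phi i))) ->
  exists (T : finType) (tau : G -> T),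
    forall g h, tau g = tau h -> forall i, phi i g = phi i h.
Proof.
move=> fin; have /choice [c hc] : forall i, exists c : nat * (G -> nat),
    (forall g, c.2 g < c.1)%N /\ forall g h, c.2 g = c.2 h -> phi i g = phi i h.
  move=> i; have /finite_set_leP [n /pcard_leP [f]] := fin i.
  have inr g : range (phi i) (phi i g) by exists g.
  exists (n, f \o phi i); split=> [g|g h /= eq_f]; first exact: (@funS _ _ _ _ f).
  by apply: (@inj _ _ _ f) eq_f; rewrite inE.
pose N := \max_i (c i).1.
exists {ffun I -> 'I_N.+1}, (fun g => [ffun i => inord ((c i).2 g)]).
move=> g h /ffunP eq_gh i; apply: (hc i).2; have := congr1 val (eq_gh i).
have le_N k : ((c i).2 k < N.+1)%N.
  by rewrite ltnS (leq_trans (ltnW ((hc i).1 k))) // /N (leq_bigmax i).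
by rewrite !ffunE /= !inordK.
Qed.

Section FiniteIndex.
Context {G : groupType} {T : finType} (H : set G) (tau : G -> T).
Hypothesis tauH : forall g h, tau g = tau h -> H (g^-1 * h)%g.

(** Elements of one colour lie in one left coset of [H], so any member of a colour class represents
    it; inverses give the second half. *)
Lemma finite_index_representatives : exists c : T -> G,
  (forall g, H ((c (tau g))^-1 * g)%g) /\ (forall g, H (g * c (tau g^-1))%g).
Proof.
have /choice [c hc] : forall t, exists g, (exists h, tau h = t) -> tau g = t.
  move=> t; have [[h th]|no] := pselect (exists h, tau h = t); first by exists h.
  by exists 1%g => /no.
exists c; split=> g; first by apply: tauH; apply: hc; exists g.
by rewrite -{1}[g]invgK; apply: tauH; rewrite hc //; exists g^-1%g.
Qed.

Lemma finite_index_power g : exists2 m, (0 < m)%N & H (g ^+ m)%g.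
Proof.
pose f (n : 'I_#|T|.+1) := tau (g ^+ n)%g.
have /injectivePn [i [j neq_ij eq_f]] : ~~ injectiveb f.
  by apply/injectiveP => /leq_card; rewrite card_ord ltnn.
wlog lt_ij : i j neq_ij eq_f / (i < j)%N.
  move=> IH; case: (ltngtP i j) => [||eq_ij]; first exact: IH.
  - by apply: IH; rewrite // eq_sym.
  - by rewrite (val_inj eq_ij) eqxx in neq_ij.
exists (j - i)%N; first by rewrite subn_gt0.
have := tauH eq_f; rewrite -{1}(subnKC (ltnW lt_ij)) expgnDr mulgA mulVg.
by rewrite mul1g.
Qed.

(** Finitely many translates of the [H]-orbit of [y] cover its full orbit, so the [H]-orbit is
    infinite too and has [M] distinct points. *)
Lemma finite_index_orbit (Y : pointedType) (op : G -> Y -> Y) (y : Y) (M : nat) :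
  (forall g h z, op (g * h)%g z = op g (op h z)) ->
  infinite_set (range (fun g => op g y)) ->
  exists s : 'I_M -> G, (forall a, H (s a)) /\ injective (fun a => op (s a) y).
Proof.
move=> opM inf; have [c [hc _]] := finite_index_representatives.
have infH : infinite_set [set op h y | h in H].
  move=> fin; apply: inf.
  apply: (@sub_finite_set _ _
    (\bigcup_(t in [set: T]) (op (c t) @` [set op h y | h in H]))).
    move=> _ [g _ <-]; exists (tau g) => //; exists (op ((c (tau g))^-1 * g)%g y).
      by exists ((c (tau g))^-1 * g)%g.
    by rewrite -opM mulVKg.
  apply: bigcup_finite; first exact: finite_finset.
  by move=> t _; apply: finite_image.
have /infiniteP /pcard_leP [e] := infH.
have /choice [s hs] : forall a : 'I_M, exists h, H h /\ op h y = e a.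
  move=> a; have [h Hh eh] : [set op h y | h in H] (e a).
    by apply: (@funS _ _ _ _ e).
  by exists h.
exists s; split=> [a|a b /=]; first by have [] := hs a.
rewrite (hs a).2 (hs b).2 => eq_e; apply: val_inj.
by apply: (@inj _ _ _ e) eq_e; rewrite inE.
Qed.

End FiniteIndex.

(* Union bound: each bad j contains at most a proportion 1/M of the points. *)
Lemma sparse_avoidable (I : finType) (M : nat)
    (bad : I -> {ffun I -> 'I_M} -> Prop) : (#|I| < M)%N ->
  (forall j p q, bad j p -> bad j q -> (forall i, i <> j -> p i = q i) -> p = q) ->
  exists p, forall j, ~ bad j p.
Proof.
move=> ltM sparse; pose B j := [set p | `[< bad j p >]]%SET.
have card_B j : (#|B j| * M <= #|{ffun I -> 'I_M}|)%N.
  (* Overwriting coordinate [j] of a bad point is injective, since a bad point is determined by its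
     other coordinates. *)
  pose upd (pv : {ffun I -> 'I_M} * 'I_M) :=
    [ffun i => if i == j then pv.2 else pv.1 i].
  have inj_upd : {in finset.setX (B j) finset.setT &, injective upd}.
    move=> [p v] [q w]; rewrite !finset.inE /= !andbT.
    move=> /asboolP bp /asboolP bq /ffunP eq_upd.
    have eq_v : v = w by have := eq_upd j; rewrite !ffunE eqxx.
    congr pair => //; apply: sparse bp bq _ => i /eqP /negbTE neq.
    by have := eq_upd i; rewrite !ffunE neq.
  have := max_card (mem (upd @: finset.setX (B j) finset.setT)).
  by rewrite card_in_imset // cardsX cardsT card_ord.
have M0 : (0 < M)%N by apply: leq_ltn_trans ltM.
suff /subsetPn [p _ hp] : ~~ (finset.setT \subset \bigcup_j B j)%SET.
  exists p => j bp; case/negP: hp; apply/bigcupP; exists j => //.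
  by rewrite finset.inE; apply/asboolP.
apply/negP => /subset_leq_card; rewrite cardsT.
have leq_cover : (#|(\bigcup_j B j)%SET| <= \sum_j #|B j|)%N.
  elim/big_rec2: _ => [|j n A _ IH]; first by rewrite cards0.
  by rewrite (leq_trans (leq_card_setU _ _)) // leq_add2l.
move=> /leq_trans /(_ leq_cover); rewrite -(leq_pmul2r M0) big_distrl /=.
have : (\sum_j #|B j| * M <= #|I| * #|{ffun I -> 'I_M}|)%N.
  by rewrite -sum_nat_const; apply: leq_sum => j _.
have card_pos : (0 < #|{ffun I -> 'I_M}|)%N.
  by rewrite card_ffun card_ord expn_gt0 M0.
move=> le1 le2; have := leq_trans le2 le1.
by rewrite mulnC (leq_pmul2r card_pos) leqNgt ltM.
Qed.

(** * Combining the actions *)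

Section LoxodromicFamilies.
Context {R : realType} {G : groupType} {X : metricType R}.
Variables (act : G -> X -> X) (delta : R) (x : X).
Hypothesis act_isometric : isometric_action act.
Hypothesis X4 : four_point (X := X) delta.

Definition attracting_orbit f :=
  range (fun g => boundary_act act g (attracting act x f)).

Lemma exists_loxodromic_orbits :
  ~ elliptic_action act x -> ~ horocyclic_action act x ->
  exists f, loxodromic act x f /\ (finite_set (attracting_orbit f) \/
    infinite_set (attracting_orbit f) /\ infinite_set (attracting_orbit f^-1%g)).
Proof.
move=> nE nH; have [f lox] := exists_loxodromic act_isometric X4 nE nH.
have [fin|inf] := pselect (finite_set (attracting_orbit f)).
  by exists f; split=> //; left.
have [finV|infV] := pselect (finite_set (attracting_orbit f^-1%g)).
  by exists f^-1%g; split; [exact: loxodromicV|left].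
by exists f; split=> //; right.
Qed.

Lemma loxodromic_family (T : finType) (H : set G) (tau : G -> T) f M :
  (forall g h, tau g = tau h -> H (g^-1 * h)%g) ->
  H 1%g -> (forall g h, H g -> H h -> H (g * h)%g) ->
  (forall g, H g -> H g^-1%g) ->
  loxodromic act x f ->
  (forall h, H h -> boundary_act act h (attracting act x f) = attracting act x f) \/
    infinite_set (attracting_orbit f) /\ infinite_set (attracting_orbit f^-1%g) ->
  exists theta : 'I_M -> 'I_M -> G, (forall a b, H (theta a b)) /\
    forall u, H u -> mostly_loxodromic act x u theta.
Proof.
move=> tauH H1 HM HV lox; have [m m0 Hm] := finite_index_power tauH f.
have HX g n : H g -> H (g ^+ n)%g.
  by move=> Hg; elim: n => [|n IH]; rewrite ?expg0 ?expgS //; apply: HM.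
case=> [fix_f|[inf infV]].
  have [K hK] := fixing_mostly_loxodromic act_isometric X4 M m0 lox.
  exists (fun a _ => f ^+ (m * K * a))%g; split=> [a _|u Hu].
    by rewrite -mulnA expgnA; apply: HX.
  exact/hK/fix_f.
have opM := boundary_actM act_isometric.
have [s [Hs inj_s]] := finite_index_orbit tauH M opM inf.
have [t [Ht inj_t]] := finite_index_orbit tauH M opM infV.
(* The [t b] have distinct translates of the repelling point, so their inverses are the right-hand
   factors. *)
have [|K hK] := translates_mostly_loxodromic
    (t := fun b => (t b)^-1%g) act_isometric X4 lox inj_s.
  by move=> b b'; rewrite !invgK; apply: inj_t.
exists (fun a b => s a * f ^+ (m * K) * (t b)^-1)%g; split=> [a b|u _].
  by apply: (HM) (HV _ (Ht b)); apply: (HM) (Hs a) _; rewrite expgnA; apply: HX.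
by apply: hK; rewrite leq_pmull.
Qed.

End LoxodromicFamilies.

Theorem lemma1p6 (R : realType) (l : nat) (hl : (1 <= l)%N) (G : groupType)
  (X : 'I_l -> metricType R) (x0 : forall i : 'I_l, X i)
  (act : forall i : 'I_l, G -> X i -> X i)
  (hX : forall i : 'I_l, gromov_hyperbolic (X i))
  (hact : forall i : 'I_l, isometric_action (act i))
  (hne : forall i : 'I_l, ~ elliptic_action (act i) (x0 i))
  (hnh : forall i : 'I_l, ~ horocyclic_action (act i) (x0 i)) :
  exists F : set G, finite_set F /\
    forall g : G, exists f : G, F f /\ simultaneously_hyperbolic act (g * f)%g.
Proof.
have /choice [delta X4] := fun i => gromov_hyperbolic_four_point (hX i).
have /choice [f hf] := fun i =>
  exists_loxodromic_orbits (hact i) (X4 i) (hne i) (hnh i).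
pose xi i := attracting (act i) (x0 i) (f i).
pose orb i := attracting_orbit (act i) (x0 i) (f i).
(* Constant when the orbit is infinite, so that every range is finite. *)
pose phi i g := if `[< finite_set (orb i) >] then boundary_act (act i) g (xi i)
  else xi i.
have [|T [tau htau]] := @finite_ranges_coloring G 'I_l _ phi.
  move=> i; rewrite /phi; case: asboolP => // _.
  by apply: sub_finite_set (finite_set1 (xi i)) => _ [g _ <-].
pose H : set G := [set h | forall i, finite_set (orb i) ->
  boundary_act (act i) h (xi i) = xi i].
have tauH g h : tau g = tau h -> H (g^-1 * h)%g.
  move=> /htau eq_phi i fin_i; have := eq_phi i.
  rewrite /phi; case: asboolP => // _ eq_gh.
  by rewrite boundary_actM // -eq_gh boundary_actK.
have H1 : H 1%g by move=> i _; rewrite boundary_act1.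
have HM g h : H g -> H h -> H (g * h)%g.
  by move=> Hg Hh i fin_i; rewrite boundary_actM // Hh // Hg.
have HV g : H g -> H g^-1%g.
  by move=> Hg i fin_i; rewrite -{1}(Hg i fin_i) boundary_actK.
(* Each [i] has two kinds of exceptions, one per coordinate, hence the index set ['I_l * bool]. *)
pose M := #|{: 'I_l * bool}|.+1.
have /choice [theta htheta] : forall i, exists theta : 'I_M -> 'I_M -> G,
    (forall a b, H (theta a b)) /\
    forall u, H u -> mostly_loxodromic (act i) (x0 i) u theta.
  move=> i; have [lox_i orb_i] := hf i.
  apply: (loxodromic_family (hact i) (X4 i) M tauH H1 HM HV lox_i).
  by case: orb_i => [fin_i|inf_i]; [left=> h Hh; apply: Hh|right].
have [c [_ hc]] := finite_index_representatives tauH.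
pose block (p : {ffun 'I_l * bool -> 'I_M}) i :=
  theta i (p (i, false)) (p (i, true)).
pose word p (r : seq 'I_l) : G := (\prod_(i <- r) block p i)%g.
exists [set (c tp.1 * word tp.2 (enum 'I_l))%g |
  tp in [set: T * {ffun 'I_l * bool -> 'I_M}]].
split=> [|g]; first exact/finite_image/finite_finset.
have [gamma [Hgamma hgamma]] : exists gamma, H gamma /\
    gamma = (g * c (tau g^-1))%g.
  by exists (g * c (tau g^-1))%g; split=> //; apply: hc.
have Hword p r : H (word p r).
  rewrite /word; elim: r => [|i r IH]; rewrite ?big_nil ?big_cons //.
  by apply: HM => //; apply: (htheta i).1.
pose before i := take (index i (enum 'I_l)) (enum 'I_l).
pose after i := drop (index i (enum 'I_l)).+1 (enum 'I_l).
have enum_split i : enum 'I_l = before i ++ i :: after i.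
  have lt_i : (index i (enum 'I_l) < size (enum 'I_l))%N.
    by rewrite index_mem mem_enum.
  rewrite -{1}(cat_take_drop (index i (enum 'I_l)) (enum 'I_l)).
  by rewrite (drop_nth i) // nth_index ?mem_enum.
have notin i : (i \notin before i) && (i \notin after i).
  have := enum_uniq 'I_l; rewrite {1}(enum_split i) cat_uniq /= negb_or.
  by case/and3P=> _ /andP[-> _] /andP[-> _].
pose u p i := (word p (after i) * gamma * word p (before i))%g.
have Hu p i : H (u p i) by apply: (HM) (Hword _ _); apply: HM.
(* Exceptions are chosen as a function of [i] and [u] alone, so points [p] with equal [u] share
   them; outside [H] the value is a dummy. *)
have /choice [R12 hR12] : forall iu : 'I_l * G, exists
    R12 : ('I_M -> 'I_M -> Prop) * ('I_M -> 'I_M -> Prop), H iu.2 ->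
    [/\ forall a a' b, R12.1 a b -> R12.1 a' b -> a = a',
        forall a b b', R12.2 a b -> R12.2 a b' -> b = b' &
        forall a b, ~ R12.1 a b -> ~ R12.2 a b ->
          loxodromic (act iu.1) (x0 iu.1) (iu.2 * theta iu.1 a b)%g].
  case=> i v; have [Hv|nHv] := pselect (H v); last first.
    by exists (fun _ _ => False, fun _ _ => False).
  by have [R1 [R2 ?]] := (htheta i).2 v Hv; exists (R1, R2).
pose bad (ib : 'I_l * bool) p := let R := R12 (ib.1, u p ib.1) in
  let a := p (ib.1, false) in let b := p (ib.1, true) in
  if ib.2 then R.2 a b else R.1 a b.
have word_eq (p q : {ffun 'I_l * bool -> 'I_M}) (i : 'I_l) r : i \notin r ->
    (forall j, j.1 <> i -> p j = q j) -> word p r = word q r.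
  move=> ir eq_pq; rewrite /word !big_seq; apply: eq_bigr => j jr.
  have neq : j <> i by move=> eq_ji; rewrite -eq_ji jr in ir.
  by rewrite /block !eq_pq.
have [|[i b] p q bp bq off|p good] :=
  @sparse_avoidable ('I_l * bool)%type M bad; first exact: ltnSn.
  (* [p] and [q] differ only at a coordinate of [i], which [u] does not read. *)
  have u_pq : u p i = u q i.
    have /andP[ib ia] := notin i.
    rewrite /u !(word_eq p q i) // => j ji; apply: off => eq_j;
      by rewrite eq_j in ji.
  have [sparse1 sparse2 _] := hR12 (i, u p i) (Hu p i).
  apply/ffunP => j; have [->|/eqP neq] := eqVneq j (i, b); last exact: off.
  move: bp bq off; rewrite /bad /= -u_pq.
  case: b => bp bq off.
    by rewrite (off (i, false)) // in bp; apply: sparse2 bp bq.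
  by rewrite (off (i, true)) // in bp; apply: sparse1 bp bq.
exists (c (tau g^-1) * word p (enum 'I_l))%g; split.
  by exists (tau g^-1%g, p).
move=> i; apply: (loxodromic_hyperbolic (hact i) (X4 i) (x := x0 i)).
(* Conjugation rotates the factors after block [i] to the front. *)
apply: (@loxodromic_conjP _ _ _ _ (hact i) _ (word p (after i))^-1%g).
have -> : ((g * (c (tau g^-1) * word p (enum 'I_l))) ^ (word p (after i))^-1 =
    u p i * block p i)%g.
  rewrite /u hgamma conjgE invgK [word p (enum 'I_l)]/word (enum_split i).
  rewrite big_cat big_cons /=.
  by rewrite -/(word p (before i)) -/(word p (after i)) !mulgA mulgK.
have [_ _ lox] := hR12 (i, u p i) (Hu p i).
by apply: lox; [exact: (good (i, false))|exact: (good (i, true))].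
Qed.
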